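(* Let $\tau>0$, $\eta>0$, $\sigma\in(-1,1)$ and let $\Gamma^m=\mathbf{X}^m=(x^m,y^m)^T\in\mathbb{X}^h$ be a given polygonal curve, with $x_l^m=x^m(0)$, $x_r^m=x^m(1)$. Assume that $$\text{(i)}\ \ (n^m_{1,1})^2+(n^m_{N,1})^2>0;\qquad\text{(ii)}\ \ \min_{1\le j\le N}|\mathbf{h}^m_j|=\min_{1\le j\le N}|\mathbf{X}^m(\rho_j)-\mathbf{X}^m(\rho_{j-1})|>0.$$ Then the full discretization is well-posed, i.e. there exists a unique $(\mathbf{X}^{m+1},\kappa^{m+1})\in\mathbb{X}^h\times\mathbb{K}^h$, with $\mathbf{X}^{m+1}=(x^{m+1},y^{m+1})^T$, $x_l^{m+1}=x^{m+1}(0)$, $x_r^{m+1}=x^{m+1}(1)$, such that $$\Bigl(\frac{\mathbf{X}^{m+1}-\mathbf{X}^m}{\tau}\cdot\mathbf{n}^m,\psi^h\Bigr)^h_{\Gamma^m}+\bigl(\partial_s\kappa^{m+1},\partial_s\psi^h\bigr)_{\Gamma^m}=0,\qquad\forall\,\psi^h\in\mathbb{K}^h,$$ $$\bigl(\kappa^{m+1},\mathbf{n}^m\cdot\boldsymbol{\omega}^h\bigr)^h_{\Gamma^m}-\bigl(\partial_s\mathbf{X}^{m+1},\partial_s\boldsymbol{\omega}^h\bigr)_{\Gamma^m}+\sigma\bigl[\omega^h_1(1)-\omega^h_1(0)\bigr]-\frac{1}{\eta\tau}\bigl[\omega^h_1(0)(x_l^{m+1}-x_l^m)+\omega^h_1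(1)(x_r^{m+1}-x_r^m)\bigr]=0,\qquad\forall\,\boldsymbol{\omega}^h=(\omega^h_1,\omega^h_2)^T\in\mathbb{X}^h.$$
   Context: $\mathbf{I}=[0,1]$; $N\ge1$ is an integer, $h=1/N$, $\rho_j=jh$ and $I_j=[\rho_{j-1},\rho_j]$. $\mathbb{K}^h$ is the space of continuous functions on $\mathbf{I}$ that are affine on each $I_j$; $\mathbb{K}^h_0=\{u\in\mathbb{K}^h:u(0)=u(1)=0\}$; $\mathbb{X}^h=\mathbb{K}^h\times\mathbb{K}^h_0$. Write $\mathbf{h}^m_j=\mathbf{X}^m(\rho_j)-\mathbf{X}^m(\rho_{j-1})$. On $I_j$ the unit tangent of $\Gamma^m$ is $\boldsymbol{\tau}^m_j=\mathbf{h}^m_j/|\mathbf{h}^m_j|$ and the unit normal is $\mathbf{n}^m_j=(n^m_{j,1},n^m_{j,2})^T=-(\boldsymbol{\tau}^m_j)^\perp$, where $(\cdot)^\perp$ is clockwise rotation by $90$ degrees (so $(a,b)^T\mapsto(b,-a)^T$); $\mathbf{n}^m$ is the piecewise constant function with value $\mathbf{n}^m_j$ on $I_j$. On $I_j$, $\partial_s=\frac{h}{|\mathbf{h}^m_j|}\partial_\rho$ (derivative with respect to arc length of $\Gamma^m$), also when applied to $\mathbf{X}^{m+1},\kappa^{m+1}$ and test functions. $(u,v)_{\Gamma^m}$ is the $L^2$ inner product along $\Gamma^m$ with respect to arc length, and the mass-lumped inner product is $$(u,v)^h_{\Gamma^m}=\frac12\sum_{j=1}^N|\mathbf{h}^m_j|\bigl[(u\cdot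 v)(\rho_j^-)+(u\cdot v)(\rho_{j-1}^+)\bigr],$$ with one-sided limits at the nodes. *)

(* Defs.v *)
From mathcomp Require Import all_boot all_order all_algebra.
From mathcomp Require Import all_classical all_reals all_analysis.

Set Implicit Arguments.
Unset Strict Implicit.
Unset Printing Implicit Defensive.

Import Order.TTheory GRing.Theory Num.Theory.
Import numFieldNormedType.Exports.

Local Open Scope classical_set_scope.
Local Open Scope ring_scope.

(* Functions on [0, 1] are total functions on R; nothing below depends on
   their values outside [0, 1], and they are identified when they agree on
   [0, 1]. Elements I_j = [node N j.-1, node N j] are numbered 1 <= j <= N. *)

Definition mesh (R : realType) (N : nat) : R := N%:R^-1.

Definition node (R : realType) (N j : nat) : R := j%:R * mesh R N.

Definition Kh (R : realType) (N : nat) (u : R -> R) : Prop :=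
  {within `[0, 1], continuous u} /\
  forall j : nat, (1 <= j <= N)%N ->
    exists a b : R, forall rho : R,
      rho \in `[node R N j.-1, node R N j] -> u rho = a * rho + b.

Definition Kh0 (R : realType) (N : nat) (u : R -> R) : Prop :=
  [/\ Kh N u, u 0 = 0 & u 1 = 0].

Definition Xh (R : realType) (N : nat) (X : R -> R * R) : Prop :=
  Kh N (fst \o X) /\ Kh0 N (snd \o X).

(* The library norm on R * R is the max norm, hence an explicit Euclidean
   structure. *)
Definition dot (R : realType) (v w : R * R) : R := v.1 * w.1 + v.2 * w.2.

Definition enorm (R : realType) (v : R * R) : R := Num.sqrt (dot v v).

(* Clockwise rotation by 90 degrees. *)
Definition perp (R : realType) (v : R * R) : R * R := (v.2, - v.1).

Definition seg (R : realType) (N : nat) (X : R -> R * R) (j : nat) : R * R :=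
  X (node R N j) - X (node R N j.-1).

Definition min_seg (R : realType) (N : nat) (X : R -> R * R) : R :=
  \big[Num.min/enorm (seg N X 1)]_(1 <= j < N.+1) enorm (seg N X j).

Definition tangent (R : realType) (N : nat) (X : R -> R * R) (j : nat) :
    R * R :=
  (enorm (seg N X j))^-1 *: seg N X j.

Definition normal (R : realType) (N : nat) (X : R -> R * R) (j : nat) : R * R :=
  - perp (tangent N X j).

(* The function with value c j on I_j. At a node the right-hand element is
   used; this choice is immaterial, since piecewise constant functions are only
   integrated or evaluated through one-sided limits. *)
Definition piecewise (R : realType) (V : zmodType) (N : nat) (c : nat -> V)
    (rho : R) : V :=
  \sum_(1 <= j < N.+1 | rho \in `[node R N j.-1, node R N j[) c j.

Definition normal_fun (R : realType) (N : nat) (X : R -> R * R) (rho : R) :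
    R * R :=
  piecewise N (normal N X) rho.

(* Arc length derivative along the curve X, of scalar and of vector functions. *)
Definition ds (R : realType) (N : nat) (X : R -> R * R) (u : R -> R)
    (rho : R) : R :=
  piecewise N (fun j => mesh R N / enorm (seg N X j)) rho * derive1 u rho.

Definition dsv (R : realType) (N : nat) (X u : R -> R * R) (rho : R) : R * R :=
  (ds N X (fst \o u) rho, ds N X (snd \o u) rho).

(* Integral along X with respect to arc length |X'(rho)| drho. *)
Definition arc_integral (R : realType) (X : R -> R * R) (f : R -> R) : R :=
  \int[@lebesgue_measure R]_(rho in `[0, 1])
    (f rho * enorm (derive1 (fst \o X) rho, derive1 (snd \o X) rho)).

Definition L2 (R : realType) (X : R -> R * R) (u v : R -> R) : R :=
  arc_integral X (fun rho => u rho * v rho).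

Definition L2v (R : realType) (X u v : R -> R * R) : R :=
  arc_integral X (fun rho => dot (u rho) (v rho)).

(* Mass-lumped inner product. Both uses in the scheme are between scalar
   functions. *)
Definition lumped (R : realType) (N : nat) (X : R -> R * R) (u v : R -> R) : R :=
  2^-1 * \sum_(1 <= j < N.+1) enorm (seg N X j) *
    (lim (u rho * v rho @[rho --> (node R N j)^'-]) +
     lim (u rho * v rho @[rho --> (node R N j.-1)^'+])).

Definition curvature_flow_eq (R : realType) (N : nat) (tau : R)
    (Xm X : R -> R * R) (kappa : R -> R) : Prop :=
  forall psi : R -> R, Kh N psi ->
    lumped N Xm
      (fun rho => dot (tau^-1 *: (X rho - Xm rho)) (normal_fun N Xm rho)) psi
    + L2 Xm (ds N Xm kappa) (ds N Xm psi) = 0.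

Definition curvature_eq (R : realType) (N : nat) (tau eta sigma : R)
    (Xm X : R -> R * R) (kappa : R -> R) : Prop :=
  forall omega : R -> R * R, Xh N omega ->
    lumped N Xm kappa (fun rho => dot (normal_fun N Xm rho) (omega rho))
    - L2v Xm (dsv N Xm X) (dsv N Xm omega)
    + sigma * ((omega 1).1 - (omega 0).1)
    - (eta * tau)^-1 * ((omega 0).1 * ((X 0).1 - (Xm 0).1)
                        + (omega 1).1 * ((X 1).1 - (Xm 1).1)) = 0.

Definition scheme_solution (R : realType) (N : nat) (tau eta sigma : R)
    (Xm X : R -> R * R) (kappa : R -> R) : Prop :=
  [/\ Xh N X, Kh N kappa, curvature_flow_eq N tau Xm X kappa
    & curvature_eq N tau eta sigma Xm X kappa].

(* Main.v *)
From HB Require Import structures.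
Require Import Defs.
From mathcomp Require Import all_boot all_order all_algebra.
From mathcomp Require Import all_classical all_reals all_analysis.
From mathcomp Require Import measurable_realfun.
From mathcomp Require Import ring lra zify.

Set Implicit Arguments.
Unset Strict Implicit.
Unset Printing Implicit Defensive.

Import Order.TTheory GRing.Theory Num.Theory.
Import numFieldNormedType.Exports.
Local Open Scope classical_set_scope.
Local Open Scope ring_scope.

(** The scheme is a square linear system in disguise. Testing the two equations
  together against a pair (omega, psi) turns them into one variational problem
  form(X, kappa; omega, psi) = load(omega, psi), with form bilinear and load
  linear ([scheme_solutionP]). Functions of K^h are determined by their values
  at the nodes, trial and test space have the same finite dimension, so unique
  solvability amounts to the homogeneous problem having only the zero solution
  ([nondegenerate_form_solvable]).

  For the homogeneous problem take omega = X and psi = tau * kappa. The two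
  lumped terms, one in each equation, are the same number with opposite signs
  and cancel, leaving

    tau |d_s kappa|^2 + |d_s X|^2 + (x(0)^2 + x(1)^2) / (eta tau) = 0.

  Every term is nonnegative, hence kappa and X are constant, x = 0 by the
  contact-line term and y = 0 by the boundary condition
  ([scheme_form_energy_eq0]). What is left is a constant c = kappa with
  (c, n . omega)^h = 0 for every omega. Tests that move a single end of the
  curve horizontally give c n_(1,1) = 0 and c n_(N,1) = 0, and condition (i)
  says that these two components do not both vanish ([nodal_mass_cst_inj]).
  Condition (ii) makes the element lengths invertible.

  The analysis lies in evaluating the integrals and the one-sided limits of
  the scheme: for functions of K^h the lumped product and the stiffness
  integral are the finite sums [nodal_mass] and [nodal_stiff] over nodal
  values ([lumped_normal], [L2_ds], [L2v_dsv]), after which all of the above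
  is algebra. *)

(** * Square variational problems *)

(** Uniqueness implies existence by a dimension count: the map sending u to the
  values of b u on a basis is injective into a space of the same dimension,
  hence onto. *)
Lemma nondegenerate_form_solvable (F : fieldType) (V : vectType F)
    (b : V -> V -> F) (l : V -> F) :
    (forall v, linear (b^~ v : V -> F^o)) ->
    (forall u, linear (b u : V -> F^o)) ->
    linear (l : V -> F^o) ->
    (forall u, (forall v, b u v = 0) -> u = 0) ->
  exists u, forall v, b u v = l v.
Proof.
move=> bl br ll nd.
set n := \dim (fullv : {vspace V}); set e := vbasis (fullv : {vspace V}).
pose T (u : V) : 'rV[F]_n := \row_i b u e`_i.
have Tlin : linear T.
  by move=> a u v; apply/rowP => i; rewrite !mxE bl.
pose TT : {linear V -> 'rV[F]_n} :=
    HB.pack T (GRing.isLinear.Build F V 'rV[F]_n _ T Tlin).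
pose f := linfun TT.
have expand (g : V -> F) (gl : linear (g : V -> F^o)) v :
    g v = \sum_i coord e i v * g e`_i.
  pose G : {linear V -> F^o} := HB.pack (g : V -> F^o)
    (GRing.isLinear.Build F V F^o _ (g : V -> F^o) gl).
  have -> : g v = G v by [].
  rewrite {1}(coord_vbasis (memvf v)) linear_sum; apply: eq_bigr => i _.
  by rewrite linearZ.
(* f u = 0 says that b u vanishes on the basis, so on the whole space. *)
have ker0 : lker f == 0%VS.
  rewrite -subv0; apply/subvP => u; rewrite memv_ker memv0 => /eqP fu0.
  apply/eqP/nd => v; rewrite (expand _ (br u)) big1 // => i _.
  have /rowP/(_ i) : T u = 0 by rewrite -fu0 lfunE.
  by rewrite !mxE => ->; rewrite mulr0.
have lim : limg f = fullv.
  apply/eqP; rewrite eqEdim subvf /= limg_dim_eq ?(eqP ker0) ?capv0 //.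
  by rewrite [X in (X <= _)%N]dimvf /dim /= mul1n.
have /memv_imgP[u _ lE] : (\row_i l e`_i : 'rV[F]_n) \in limg f.
  by rewrite lim memvf.
exists u => v; rewrite (expand _ (br u)) (expand _ ll); apply: eq_bigr => i _.
by congr (_ * _); move/rowP: lE => /(_ i); rewrite lfunE !mxE => ->.
Qed.

(** * The uniform mesh and functions affine on its elements *)

Section Mesh.
Variables (R : realType) (N : nat).
Hypothesis N_gt0 : (0 < N)%N.

Let N_neq0 : N%:R != 0 :> R. Proof. by rewrite pnatr_eq0 -lt0n. Qed.

Lemma mesh_gt0 : 0 < mesh R N.
Proof. by rewrite invr_gt0 ltr0n. Qed.

Lemma mulr_natl_mesh : N%:R * mesh R N = 1.
Proof. by rewrite divff. Qed.

Lemma mulr_natl_node j : N%:R * node R N j = j%:R.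
Proof. by rewrite mulrCA mulr_natl_mesh mulr1. Qed.

Lemma node0 : node R N 0 = 0.
Proof. exact: mul0r. Qed.

Lemma nodeN : node R N N = 1.
Proof. exact: mulr_natl_mesh. Qed.

Lemma nodeS j : node R N j.+1 = node R N j + mesh R N.
Proof. by rewrite /node -natr1 mulrDl mul1r. Qed.

Lemma ler_node i j : (node R N i <= node R N j) = (i <= j)%N.
Proof. by rewrite ler_pM2r ?mesh_gt0// ler_nat. Qed.

Lemma ltr_node i j : (node R N i < node R N j) = (i < j)%N.
Proof. by rewrite ltr_pM2r ?mesh_gt0// ltr_nat. Qed.

Lemma piecewise_element (V : zmodType) (c : nat -> V) (j : nat) rho :
  (1 <= j <= N)%N -> rho \in `[node R N j.-1, node R N j[ ->
  piecewise N c rho = c j.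
Proof.
move=> jN; rewrite in_itv/= => /andP[rho_ge rho_lt].
rewrite /piecewise big_mkcond (bigD1_seq j) ?mem_index_iota ?iota_uniq//=.
rewrite in_itv/= rho_ge rho_lt big1_seq ?addr0// => i /andP[ij _].
rewrite in_itv/=; case: ifP => // /andP[].
move=> /le_lt_trans/(_ rho_lt); rewrite ltr_node => ij1 /(le_lt_trans rho_ge).
by rewrite ltr_node => ji; exfalso; move/eqP: ij; lia.
Qed.

(** On the closed element the function coincides with a globally defined affine
  map, whose continuity yields the one-sided limits. *)
Lemma cvg_node_left (u : R -> R) j : Kh N u -> (1 <= j <= N)%N ->
  u rho @[rho --> (node R N j)^'-] --> u (node R N j).
Proof.
move=> [_ affu] jN; have [a [b uE]] := affu j jN.
have ltj : node R N j.-1 < node R N j by rewrite ltr_node; lia.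
rewrite uE ?in_itv/= ?lexx ?ltW//.
apply: (@cvg_trans _ ((fun rho => a * rho + b) rho @[rho --> (node R N j)^'-])).
  apply: near_eq_cvg; near=> x; rewrite uE// in_itv/=; apply/andP; split.
    by apply: ltW; near: x; exact: nbhs_left_gt.
  by near: x; exact: nbhs_left_le.
apply: cvg_at_left_filter.
by apply: cvgD; [apply: cvgM; [exact: cvg_cst|exact: cvg_id]|exact: cvg_cst].
Unshelve. all: by end_near. Qed.

Lemma cvg_node_right (u : R -> R) j : Kh N u -> (1 <= j <= N)%N ->
  u rho @[rho --> (node R N j.-1)^'+] --> u (node R N j.-1).
Proof.
move=> [_ affu] jN; have [a [b uE]] := affu j jN.
have ltj : node R N j.-1 < node R N j by rewrite ltr_node; lia.
rewrite uE ?in_itv/= ?lexx ?ltW//.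
apply: (@cvg_trans _ ((fun rho => a * rho + b) rho
                        @[rho --> (node R N j.-1)^'+])).
  apply: near_eq_cvg; near=> x; rewrite uE// in_itv/=; apply/andP; split.
    by near: x; exact: nbhs_right_ge.
  by apply: ltW; near: x; exact: nbhs_right_lt.
apply: cvg_at_right_filter.
by apply: cvgD; [apply: cvgM; [exact: cvg_cst|exact: cvg_id]|exact: cvg_cst].
Unshelve. all: by end_near. Qed.

Lemma near_piecewise_left (c : nat -> R * R) j : (1 <= j <= N)%N ->
  \forall rho \near (node R N j)^'-, piecewise N c rho = c j.
Proof.
move=> jN; near=> x; apply: piecewise_element => //.
rewrite in_itv/=; apply/andP; split; last by near: x; exact: nbhs_left_lt.
by apply: ltW; near: x; apply: nbhs_left_gt; rewrite ltr_node; lia.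
Unshelve. all: by end_near. Qed.

Lemma near_piecewise_right (c : nat -> R * R) j : (1 <= j <= N)%N ->
  \forall rho \near (node R N j.-1)^'+, piecewise N c rho = c j.
Proof.
move=> jN; near=> x; apply: piecewise_element => //.
rewrite in_itv/=; apply/andP; split; first by near: x; exact: nbhs_right_ge.
by near: x; apply: nbhs_right_lt; rewrite ltr_node; lia.
Unshelve. all: by end_near. Qed.

(** The restriction to the open element matters: at a node [derive1] need not be
  either of the two slopes. *)
Lemma Kh_derive1 (u : R -> R) j rho : Kh N u -> (1 <= j <= N)%N ->
  rho \in `]node R N j.-1, node R N j[ ->
  derive1 u rho = N%:R * (u (node R N j) - u (node R N j.-1)).
Proof.
move=> [_ affu] jN rhoj; have [a [b uE]] := affu j jN.
have ltj : node R N j.-1 < node R N j by rewrite ltr_node; lia.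
rewrite !uE ?in_itv/= ?lexx ?ltW//.
rewrite derive1E (@near_eq_derive _ _ _ u (fun r => a * r + b)); last first.
  near=> x; apply: uE; apply: subset_itv_oo_cc.
  by near: x; exact: near_in_itvoo.
rewrite deriveD// deriveM// !derive_cst derive_id scaler0 !addr0.
have := mulr_natl_node j; have := mulr_natl_node j.-1.
move=> e1 e2; rewrite {1}/GRing.scale/= mulr1.
transitivity (a * (N%:R * node R N j - N%:R * node R N j.-1)); last by ring.
have j1 : j%:R = j.-1%:R + 1 :> R by rewrite natr1 prednK//; case/andP: jN.
by rewrite e1 e2 j1; ring.
Unshelve. all: by end_near. Qed.

(** The integrand is unconstrained at the nodes, which form a null set.
  Measurability is carried along in the induction because it is what additivity
  of the integral over adjacent intervals asks for. *)
Lemma integral_elementwise_constant (f : R -> R) (c : nat -> R) n :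
  (forall j rho, (1 <= j <= n)%N ->
     rho \in `]node R N j.-1, node R N j[ -> f rho = c j) ->
  measurable_fun `[0, node R N n] f /\
  (\int[@lebesgue_measure R]_(rho in [set` `[0, node R N n]%R]) (f rho)%:E
    = (\sum_(1 <= j < n.+1) c j * mesh R N)%:E)%E.
Proof.
elim: n => [|n IHn] fE.
  rewrite node0 set_itv1 big_geq//; split; first exact: measurable_fun_set1.
  by rewrite integral_set1.
have {IHn}[j rho|mf intf] := IHn.
  by move=> jn; apply: fE; lia.
have mo : measurable_fun `]node R N n, node R N n.+1[ f.
  apply: (eq_measurable_fun (cst (c n.+1))); last exact: measurable_cst.
  by move=> x; rewrite inE/= => xn; rewrite (fE n.+1)//= leqnn.
have mc : measurable_fun `]node R N n, node R N n.+1] f.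
  exact: measurable_fun_itv_oc mo.
have itvE : [set` `[0, node R N n.+1]] =
    `[0, node R N n] `|` `]node R N n, node R N n.+1].
  rewrite -itv_bndbnd_setU// bnd_simp ?ler_node// -node0 ler_node//.
have mU : measurable_fun `[0, node R N n.+1] f.
  by rewrite itvE; apply/measurable_funU.
split => //; rewrite itvE integral_setU//; first last.
- rewrite disj_set2E; apply/eqP; rewrite -subset0 => x [/=].
  by rewrite !in_itv/= => /andP[_ xn] /andP[+ _]; rewrite ltNge xn.
- by rewrite -itvE; exact/measurable_EFinP.
rewrite intf (eq_integral_itv_bounded (g := cst (c n.+1)))//; last first.
  by move=> x xn; rewrite (fE n.+1)//= leqnn.
rewrite [X in (_ + X)%E](integral_cst _ _ (c n.+1)%:E)//=.
rewrite lebesgue_measure_itv/= lte_fin ltr_node ltnSn.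
by rewrite -EFinB nodeS addrAC subrr add0r -EFinM -EFinD [in RHS]big_nat_recr.
Qed.

End Mesh.

(** * Nodal interpolation *)

Section FiniteElementSpace.
Variables (R : realType) (N : nat).
Hypothesis N_gt0 : (0 < N)%N.

Lemma Kh_lin a (u v : R -> R) : Kh N u -> Kh N v ->
  Kh N (fun rho => a * u rho + v rho).
Proof.
move=> [cu au] [cv av]; split=> [x|j jN].
  by apply: cvgD; [apply: cvgMr; exact: cu|exact: cv].
have [[p [q uE]] [r [s vE]]] := (au j jN, av j jN).
exists (a * p + r), (a * q + s) => rho rhoj.
by rewrite uE// vE//; ring.
Qed.

Lemma Kh_cst0 : Kh N (fun=> 0 : R).
Proof.
split=> [x|j jN]; first exact: cvg_cst.
by exists 0, 0 => rho _; rewrite mul0r addr0.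
Qed.

Lemma Kh_sum (I : Type) (s : seq I) (c : I -> R) (u : I -> R -> R) :
  (forall i, Kh N (u i)) -> Kh N (fun rho => \sum_(i <- s) c i * u i rho).
Proof.
move=> uK; elim: s => [|i s IHs].
  under eq_fun do rewrite big_nil; exact: Kh_cst0.
under eq_fun do rewrite big_cons; exact: Kh_lin.
Qed.

Definition hat (j : nat) (rho : R) : R :=
  Num.max 0 (1 - `|N%:R * rho - j%:R|).

Lemma hat_node j i : (i <= N)%N -> hat j (node R N i) = (i == j)%:R.
Proof.
move=> iN; rewrite /hat mulr_natl_node//.
case: ltngtP => ij.
- have : i.+1%:R <= j%:R :> R by rewrite ler_nat.
  by rewrite -natr1 => h; apply/max_idPl; rewrite distrC ger0_norm; lra.
- have : j.+1%:R <= i%:R :> R by rewrite ler_nat.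
  by rewrite -natr1 => h; apply/max_idPl; rewrite ger0_norm; lra.
- by rewrite ij subrr normr0 subr0; apply/max_idPr; lra.
Qed.

(** On element i the hat of node j is zero unless i = j (rising side) or
  i = j + 1 (falling side). *)
Lemma Kh_hat j : Kh N (hat j).
Proof.
split=> [|i iN].
  apply: continuous_subspaceT => x.
  have max_cont := @continuous_max R R (cst 0 : R -> R^o)
    (fun rho => 1 - `|N%:R * rho - j%:R|) x.
  apply: max_cont; first exact: cvg_cst.
  apply: cvgB; first exact: cvg_cst.
  apply: cvg_norm; apply: cvgB; last exact: cvg_cst.
  by apply: cvgM; [exact: cvg_cst|exact: cvg_id].
have pred_i : i.-1%:R = i%:R - 1 :> R.
  by rewrite -subn1 natrB//; case/andP: iN.
have lei rho : rho \in `[node R N i.-1, node R N i] ->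
    i%:R - 1 <= N%:R * rho <= i%:R.
  rewrite in_itv/= -pred_i -(mulr_natl_node R N_gt0 i.-1).
  rewrite -(mulr_natl_node R N_gt0 i).
  by rewrite !ler_pM2l ?ltr0n.
case: (ltngtP i j) => ij.
- exists 0, 0 => rho /lei/andP[? ?].
  have : i.+1%:R <= j%:R :> R by rewrite ler_nat.
  rewrite -natr1 => h; rewrite mul0r addr0; apply/max_idPl.
  by rewrite distrC ger0_norm; lra.
- have : j.+1%:R <= i%:R :> R by rewrite ler_nat.
  rewrite -natr1 => h; have [ij1|ij1] := eqVneq i j.+1.
    exists (- N%:R), (1 + j%:R) => rho /lei/andP[? ?].
    have h2 : i%:R = j%:R + 1 :> R by rewrite ij1 -natr1.
    rewrite /hat ger0_norm; last by lra.
    transitivity (1 - (N%:R * rho - j%:R)); last by ring.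
    by apply/max_idPr; lra.
  exists 0, 0 => rho /lei/andP[? ?].
  have : j.+2%:R <= i%:R :> R by rewrite ler_nat; lia.
  rewrite -!natr1 => h2; rewrite mul0r addr0; apply/max_idPl.
  by rewrite ger0_norm; lra.
- exists N%:R, (1 - j%:R) => rho /lei/andP[? ?].
  have h2 : i%:R = j%:R :> R by rewrite ij.
  rewrite /hat distrC ger0_norm; last by lra.
  transitivity (1 - (j%:R - N%:R * rho)); last by ring.
  by apply/max_idPr; lra.
Qed.

(** The shift s places the m coefficients at the nodes s, ..., s + m - 1: s = 0
  with m = N + 1 parametrizes K^h, and s = 1 with m = N - 1 parametrizes K^h_0
  since the two end nodes then carry the value zero. *)
Definition interp (m s : nat) (c : 'rV[R]_m) (rho : R) : R :=
  \sum_(i < m) c 0 i * hat (i + s) rho.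

Lemma Kh_interp m s (c : 'rV[R]_m) : Kh N (interp s c).
Proof. by apply: Kh_sum => i; exact: Kh_hat. Qed.

Lemma interp_lin m s a (c d : 'rV[R]_m) rho :
  interp s (a *: c + d) rho = a * interp s c rho + interp s d rho.
Proof.
rewrite /interp mulr_sumr -big_split; apply: eq_bigr => i _ /=.
by rewrite !mxE; ring.
Qed.

Lemma interp_node m s (c : 'rV[R]_m) (i : 'I_m) : (m + s <= N.+1)%N ->
  interp s c (node R N (i + s)) = c 0 i.
Proof.
move=> msN; rewrite /interp (bigD1 i)//= hat_node; last first.
  by have := ltn_ord i; lia.
rewrite eqxx mulr1 big1 ?addr0// => k ki.
rewrite hat_node; last by have := ltn_ord i; lia.
by rewrite eqn_add2r val_eqE eq_sym (negbTE ki) mulr0.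
Qed.

Lemma interp_node_out m s (c : 'rV[R]_m) k : (k <= N)%N ->
  (k < s)%N || (m + s <= k)%N -> interp s c (node R N k) = 0.
Proof.
move=> kN ks; rewrite /interp big1// => i _.
rewrite hat_node//; case: eqP => [ki|_]; last by rewrite mulr0.
by have := ltn_ord i; lia.
Qed.

Lemma interp_nodal (u : R -> R) k : (k <= N)%N ->
  interp 0 (\row_(i < N.+1) u (node R N i)) (node R N k) = u (node R N k).
Proof.
move=> kN; have := interp_node (\row_(i < N.+1) u (node R N i))
  (Ordinal (kN : (k < N.+1)%N)) (eq_leq (addn0 _)).
by rewrite addn0 mxE.
Qed.

Lemma interp_nodal0 (u : R -> R) k : u 0 = 0 -> u 1 = 0 -> (k <= N)%N ->
  interp 1 (\row_(i < N.-1) u (node R N i.+1)) (node R N k) = u (node R N k).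
Proof.
move=> u0 u1 kN; case: k kN => [|k] kN.
  by rewrite interp_node_out// node0.
have [kN1|kN1] := ltnP k N.-1; last first.
  have -> : k.+1 = N by lia.
  by rewrite interp_node_out ?nodeN//; lia.
have := interp_node (\row_(i < N.-1) u (node R N i.+1)) (s := 1) (Ordinal kN1).
by rewrite !addn1 mxE/= => -> //; lia.
Qed.

Lemma Kh0_interp (c : 'rV[R]_(N.-1)) : Kh0 N (interp 1 c).
Proof.
split; first exact: Kh_interp.
- by rewrite -[X in interp _ _ X](node0 R N) interp_node_out.
- by rewrite -[X in interp _ _ X](nodeN R N_gt0) interp_node_out//; lia.
Qed.

Lemma element_exists (rho : R) : rho \in `[0, 1] ->
  exists2 j, (1 <= j <= N)%N & rho \in `[node R N j.-1, node R N j].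
Proof.
rewrite in_itv/= => /andP[rho0 rho1].
have [rho_eq1|rho_neq1] := eqVneq rho 1.
  (* The right end is not in any half-open element. *)
  exists N; first by rewrite leqnn N_gt0.
  by rewrite rho_eq1 -(nodeN R N_gt0) in_itv/= !ler_node// leq_pred leqnn.
have N0 : 0 < N%:R :> R by rewrite ltr0n.
have Nrho0 : 0 <= N%:R * rho by rewrite mulr_ge0// ltW.
have /andP[le1 lt2] := truncn_itv Nrho0.
exists (Num.truncn (N%:R * rho)).+1.
  rewrite /= -(@ltr_nat R); apply: le_lt_trans le1 _.
  by rewrite gtr_pMr// lt_neqAle rho_neq1.
rewrite in_itv/= -(ler_pM2l N0) mulr_natl_node// le1/=.
by rewrite -(ler_pM2l N0) mulr_natl_node// ltW.
Qed.

Lemma eq_Kh (u v : R -> R) : Kh N u -> Kh N v ->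
  (forall k, (k <= N)%N -> u (node R N k) = v (node R N k)) ->
  {in `[0, 1], u =1 v}.
Proof.
move=> [_ au] [_ av] uv rho /element_exists[j jN rhoj].
have [[p [q uE]] [r [s vE]]] := (au j jN, av j jN).
have ltj : node R N j.-1 < node R N j by rewrite ltr_node//; lia.
rewrite (uE rho)// (vE rho)//; have := uv j; have := uv j.-1.
rewrite !uE ?in_itv/= ?lexx ?ltW// !vE ?in_itv/= ?lexx ?ltW//.
move=> /(_ ltac:(lia)) e1 /(_ ltac:(lia)) e2.
have pr : p = r.
  apply/eqP; rewrite -subr_eq0.
  have : (p - r) * (node R N j - node R N j.-1) == 0.
    by apply/eqP; lra.
  by rewrite mulf_eq0 => /orP[//|/eqP]; lra.
by rewrite pr; congr (_ + _); move: e1; rewrite pr => /addrI.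
Qed.

End FiniteElementSpace.

(** * The bilinear forms of the scheme as sums over nodal values *)

Lemma dotC (R : realType) (v w : R * R) : dot v w = dot w v.
Proof. by rewrite /dot mulrC [X in _ + X]mulrC. Qed.

Lemma dot_linl (R : realType) a (v v' w : R * R) :
  dot (a *: v + v') w = a * dot v w + dot v' w.
Proof. by rewrite /dot/= /GRing.scale/=; ring. Qed.

Lemma enormZ (R : realType) a (v : R * R) : 0 <= a ->
  enorm (a * v.1, a * v.2) = a * enorm v.
Proof.
move=> a0; rewrite /enorm /dot/=.
have -> : a * v.1 * (a * v.1) + a * v.2 * (a * v.2)
    = a ^+ 2 * (v.1 * v.1 + v.2 * v.2) by ring.
by rewrite sqrtrM ?sqr_ge0// sqrtr_sqr ger0_norm.
Qed.

Lemma lt_bigmin_mem (d : Order.disp_t) (T : orderType d) (I : eqType)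
    (r : seq I) (F : I -> T) (x x0 : T) i :
  (x < \big[Order.min/x0]_(k <- r) F k)%O -> i \in r -> (x < F i)%O.
Proof.
elim: r => // k r IHr; rewrite big_cons lt_min inE => /andP[xk /IHr xr].
by case/predU1P => [->//|/xr].
Qed.

Section NodalForms.
Variables (R : realType) (N : nat) (Xm : R -> R * R).
Hypothesis N_gt0 : (0 < N)%N.
Hypothesis min_seg_gt0 : 0 < min_seg N Xm.

Local Notation len j := (enorm (seg N Xm j)).
Local Notation nrm j := (normal N Xm j).
Local Notation nd j := (node R N j).

Lemma len_gt0 j : (1 <= j <= N)%N -> 0 < len j.
Proof.
by move=> jN; apply: lt_bigmin_mem min_seg_gt0 _; rewrite mem_index_iota ltnS.
Qed.

(** The lumped product of U . n and u: the one-sided limits at the two ends of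
  element j both see the normal of that element. *)
Definition nodal_mass (U : R -> R * R) (u : R -> R) : R :=
  2^-1 * \sum_(1 <= j < N.+1) len j *
    (dot (U (nd j)) (nrm j) * u (nd j)
     + dot (U (nd j.-1)) (nrm j) * u (nd j.-1)).

(** The stiffness form of a mesh with element lengths len j: arc length
  derivatives are difference quotients over len j, and integrating their
  product over the element multiplies by len j. *)
Definition nodal_stiff (u v : R -> R) : R :=
  \sum_(1 <= j < N.+1)
    (len j)^-1 * ((u (nd j) - u (nd j.-1)) * (v (nd j) - v (nd j.-1))).

Lemma lumped_normal (U : R -> R * R) u :
  Kh N (fst \o U) -> Kh N (snd \o U) -> Kh N u ->
  lumped N Xm (fun rho => dot (U rho) (Defs.normal_fun N Xm rho)) u
    = nodal_mass U u.
Proof.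
move=> U1 U2 Ku; congr (_ * _); apply: eq_big_nat => j jN.
congr (_ * (_ + _)); apply: cvg_lim => //.
- apply: (@cvg_trans _ ((fun rho => dot (U rho) (nrm j) * u rho) rho
                          @[rho --> (nd j)^'-])).
    apply: near_eq_cvg; near=> rho; rewrite /Defs.normal_fun.
    near: rho.
    by apply: filterS (near_piecewise_left N_gt0 (normal N Xm) jN) => rho ->.
  apply: cvgM; last exact: cvg_node_left.
  by apply: cvgD; (apply: cvgM; last exact: cvg_cst);
    [exact: (cvg_node_left N_gt0 U1)|exact: (cvg_node_left N_gt0 U2)].
- apply: (@cvg_trans _ ((fun rho => dot (U rho) (nrm j) * u rho) rho
                          @[rho --> (nd j.-1)^'+])).
    apply: near_eq_cvg; near=> rho; rewrite /Defs.normal_fun.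
    near: rho.
    by apply: filterS (near_piecewise_right N_gt0 (normal N Xm) jN) => rho ->.
  apply: cvgM; last exact: cvg_node_right.
  by apply: cvgD; (apply: cvgM; last exact: cvg_cst);
    [exact: (cvg_node_right N_gt0 U1)|exact: (cvg_node_right N_gt0 U2)].
Unshelve. all: by end_near. Qed.

Lemma ds_element (u : R -> R) j rho : Kh N u -> (1 <= j <= N)%N ->
  rho \in `]nd j.-1, nd j[ ->
  ds N Xm u rho = (len j)^-1 * (u (nd j) - u (nd j.-1)).
Proof.
move=> Ku jN rhoj; rewrite /ds (piecewise_element N_gt0 _ jN); last first.
  exact: subset_itv_oo_co rhoj.
rewrite (Kh_derive1 N_gt0 Ku jN rhoj) mulrACA [mesh R N * _]mulrC.
rewrite mulr_natl_mesh//.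
exact: mul1r.
Qed.

(** The speed of Xm on element j is N * len j, which the mesh size 1 / N turns
  into the length of the element. *)
Lemma arc_integral_elementwise_constant (f : R -> R) (c : nat -> R) : Xh N Xm ->
  (forall j rho, (1 <= j <= N)%N -> rho \in `]nd j.-1, nd j[ -> f rho = c j) ->
  arc_integral Xm f = \sum_(1 <= j < N.+1) len j * c j.
Proof.
move=> [X1 [X2 _ _]] fE; rewrite /arc_integral /Rintegral.
have := @integral_elementwise_constant R N N_gt0
  (fun rho => f rho * enorm (derive1 (fst \o Xm) rho, derive1 (snd \o Xm) rho))
  (fun j => c j * (N%:R * len j)) N.
rewrite nodeN// => -[j rho jN rhoj|_ ->].
  rewrite (fE j)// (Kh_derive1 N_gt0 X1 jN rhoj) (Kh_derive1 N_gt0 X2 jN rhoj).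
  by congr (_ * _); rewrite -enormZ ?ler0n.
rewrite /=; apply: eq_big_nat => j jN.
by rewrite -mulrA mulrAC mulr_natl_mesh// mul1r mulrC.
Qed.

Lemma L2_ds (u v : R -> R) : Xh N Xm -> Kh N u -> Kh N v ->
  L2 Xm (ds N Xm u) (ds N Xm v) = nodal_stiff u v.
Proof.
move=> XmX Ku Kv; rewrite /L2 (@arc_integral_elementwise_constant _ (fun j =>
  (len j)^-1 * (u (nd j) - u (nd j.-1)) *
  ((len j)^-1 * (v (nd j) - v (nd j.-1)))))//; last first.
  by move=> j rho jN rhoj; rewrite !(@ds_element _ j).
apply: eq_big_nat => j jN; have := len_gt0 jN => lj.
by rewrite !mulrA divff ?gt_eqF// mul1r -!mulrA mulrCA.
Qed.

Lemma L2v_dsv (X Y : R -> R * R) : Xh N Xm -> Xh N X -> Xh N Y ->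
  L2v Xm (dsv N Xm X) (dsv N Xm Y)
    = nodal_stiff (fst \o X) (fst \o Y) + nodal_stiff (snd \o X) (snd \o Y).
Proof.
move=> XmX [X1 [X2 _ _]] [Y1 [Y2 _ _]].
rewrite /L2v (@arc_integral_elementwise_constant _ (fun j =>
  dot ((len j)^-1 * ((X (nd j)).1 - (X (nd j.-1)).1),
       (len j)^-1 * ((X (nd j)).2 - (X (nd j.-1)).2))
      ((len j)^-1 * ((Y (nd j)).1 - (Y (nd j.-1)).1),
       (len j)^-1 * ((Y (nd j)).2 - (Y (nd j.-1)).2))))//; last first.
  by move=> j rho jN rhoj; rewrite /dsv !(@ds_element _ j).
rewrite -big_split; apply: eq_big_nat => j jN; have := len_gt0 jN => lj.
by rewrite /dot/=; field; rewrite gt_eqF.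
Qed.

Lemma nodal_mass_linl a (U V : R -> R * R) u :
  nodal_mass (fun rho => a *: U rho + V rho) u
    = a * nodal_mass U u + nodal_mass V u.
Proof.
rewrite /nodal_mass mulrCA -mulrDr; congr (_ * _).
rewrite mulr_sumr -big_split; apply: eq_bigr => j _ /=.
by rewrite !dot_linl; ring.
Qed.

Lemma nodal_mass_linr a (U : R -> R * R) u v :
  nodal_mass U (fun rho => a * u rho + v rho)
    = a * nodal_mass U u + nodal_mass U v.
Proof.
rewrite /nodal_mass mulrCA -mulrDr; congr (_ * _).
by rewrite mulr_sumr -big_split; apply: eq_bigr => j _ /=; ring.
Qed.

Lemma nodal_stiffC u v : nodal_stiff u v = nodal_stiff v u.
Proof. by apply: eq_bigr => j _; rewrite [X in _ * X]mulrC. Qed.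

Lemma nodal_stiff_linl a u v w :
  nodal_stiff (fun rho => a * u rho + v rho) w
    = a * nodal_stiff u w + nodal_stiff v w.
Proof.
by rewrite /nodal_stiff mulr_sumr -big_split; apply: eq_bigr => j _ /=; ring.
Qed.

Lemma nodal_stiff_linr a u v w :
  nodal_stiff w (fun rho => a * u rho + v rho)
    = a * nodal_stiff w u + nodal_stiff w v.
Proof. by rewrite nodal_stiffC nodal_stiff_linl !(nodal_stiffC w). Qed.

Lemma nodal_mass0l u : nodal_mass (fun=> 0) u = 0.
Proof.
rewrite /nodal_mass big1 ?mulr0// => j _.
by rewrite /dot/= !(mul0r, mulr0, addr0).
Qed.

Lemma nodal_mass0r U : nodal_mass U (fun=> 0) = 0.
Proof.
by rewrite /nodal_mass big1 ?mulr0// => j _; rewrite !mulr0 addr0 mulr0.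
Qed.

Lemma nodal_stiff0r u : nodal_stiff u (fun=> 0) = 0.
Proof. by rewrite /nodal_stiff big1// => j _; rewrite subr0 !mulr0. Qed.

Lemma eq_nodal_mass U U' u u' :
  (forall k, (k <= N)%N -> U (nd k) = U' (nd k)) ->
  (forall k, (k <= N)%N -> u (nd k) = u' (nd k)) ->
  nodal_mass U u = nodal_mass U' u'.
Proof.
move=> UU uu; congr (_ * _); apply: eq_big_nat => j /andP[_ jN].
by rewrite !UU ?uu// (leq_trans (leq_pred _)).
Qed.

Lemma eq_nodal_stiff u u' v v' :
  (forall k, (k <= N)%N -> u (nd k) = u' (nd k)) ->
  (forall k, (k <= N)%N -> v (nd k) = v' (nd k)) ->
  nodal_stiff u v = nodal_stiff u' v'.
Proof.
move=> uu vv; apply: eq_big_nat => j /andP[_ jN].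
by rewrite !uu ?vv// (leq_trans (leq_pred _)).
Qed.

Lemma nodal_stiff_term_ge0 (u : R -> R) j : (1 <= j < N.+1)%N ->
  0 <= (len j)^-1 * ((u (nd j) - u (nd j.-1)) * (u (nd j) - u (nd j.-1))).
Proof.
move=> jN; apply: mulr_ge0; last by rewrite -expr2 sqr_ge0.
by rewrite invr_ge0 ltW// len_gt0.
Qed.

Lemma nodal_stiff_ge0 u : 0 <= nodal_stiff u u.
Proof.
rewrite /nodal_stiff big_nat sumr_ge0// => j; exact: nodal_stiff_term_ge0.
Qed.

Lemma nodal_stiff_eq0 u k : nodal_stiff u u = 0 -> (k <= N)%N ->
  u (nd k) = u 0.
Proof.
rewrite /nodal_stiff big_nat => /eqP; rewrite psumr_eq0; last first.
  by move=> j; exact: nodal_stiff_term_ge0.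
move=> /allP incr0; elim: k => [|k IHk] kN; first by rewrite node0.
rewrite -IHk ?(ltnW kN)//.
have := incr0 k.+1; rewrite mem_index_iota/= !ltnS kN => /(_ isT).
rewrite mulf_eq0 invr_eq0 gt_eqF ?len_gt0//= mulf_eq0 orbb subr_eq0.
by move/eqP.
Qed.

End NodalForms.

(** * The scheme as a variational problem *)

Section Scheme.
Variables (R : realType) (N : nat) (tau eta sigma : R) (Xm : R -> R * R).
Hypothesis N_gt0 : (0 < N)%N.
Hypothesis tau_gt0 : 0 < tau.
Hypothesis eta_gt0 : 0 < eta.
Hypothesis XmX : Xh N Xm.
Hypothesis end_normals : 0 < (normal N Xm 1).1 ^+ 2 + (normal N Xm N).1 ^+ 2.
Hypothesis min_seg_gt0 : 0 < min_seg N Xm.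

Local Notation mass := (nodal_mass N Xm).
Local Notation stiff := (nodal_stiff N Xm).
Local Notation nd j := (node R N j).

(** The first equation minus the second, with the terms in the given curve and
  in sigma moved to [scheme_load]. With this sign the lumped terms cancel on
  the diagonal and the remaining ones are nonnegative. *)
Definition scheme_form (X : R -> R * R) (kappa : R -> R)
    (omega : R -> R * R) (psi : R -> R) : R :=
  tau^-1 * mass X psi + stiff kappa psi - mass omega kappa
  + (stiff (fst \o X) (fst \o omega) + stiff (snd \o X) (snd \o omega))
  + (eta * tau)^-1 * ((omega 0).1 * (X 0).1 + (omega 1).1 * (X 1).1).

Definition scheme_load (omega : R -> R * R) (psi : R -> R) : R :=
  tau^-1 * mass Xm psi + sigma * ((omega 1).1 - (omega 0).1)
  + (eta * tau)^-1 * ((omega 0).1 * (Xm 0).1 + (omega 1).1 * (Xm 1).1).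

Lemma Xh_lin a (X Y : R -> R * R) : Xh N X -> Xh N Y ->
  Xh N (fun rho => a *: X rho + Y rho).
Proof.
move=> [X1 [X2 X20 X21]] [Y1 [Y2 Y20 Y21]].
have sndE t : (snd \o X) t = 0 -> (snd \o Y) t = 0 ->
    (a *: X t + Y t).2 = 0.
  by rewrite /= => Xt Yt; rewrite Xt Yt scaler0 addr0.
split; first exact: (Kh_lin a X1 Y1).
by split; [exact: (Kh_lin a X2 Y2)|exact: sndE|exact: sndE].
Qed.

Lemma Xh_cst0 : Xh N (fun=> 0 : R * R).
Proof. by split; [exact: Kh_cst0|split => //; exact: Kh_cst0]. Qed.

Lemma scheme_form_linl a X kappa Y lambda omega psi :
  scheme_form (fun rho => a *: X rho + Y rho)
      (fun rho => a * kappa rho + lambda rho) omega psi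
    = a * scheme_form X kappa omega psi + scheme_form Y lambda omega psi.
Proof.
rewrite /scheme_form nodal_mass_linl nodal_mass_linr.
rewrite nodal_stiff_linl (nodal_stiff_linl _ _ a (fst \o X) (fst \o Y)).
rewrite (nodal_stiff_linl _ _ a (snd \o X) (snd \o Y)) /= /GRing.scale/=.
by ring.
Qed.

Lemma scheme_form_linr a X kappa omega psi omega' psi' :
  scheme_form X kappa (fun rho => a *: omega rho + omega' rho)
      (fun rho => a * psi rho + psi' rho)
    = a * scheme_form X kappa omega psi + scheme_form X kappa omega' psi'.
Proof.
rewrite /scheme_form nodal_mass_linl nodal_mass_linr.
rewrite nodal_stiff_linr.
rewrite (nodal_stiff_linr _ _ a (fst \o omega) (fst \o omega')).
rewrite (nodal_stiff_linr _ _ a (snd \o omega) (snd \o omega')).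
by rewrite /= /GRing.scale/=; ring.
Qed.

Lemma scheme_load_lin a omega psi omega' psi' :
  scheme_load (fun rho => a *: omega rho + omega' rho)
      (fun rho => a * psi rho + psi' rho)
    = a * scheme_load omega psi + scheme_load omega' psi'.
Proof.
by rewrite /scheme_load nodal_mass_linr /= /GRing.scale/=; ring.
Qed.

Lemma scheme_form_eq_nodes X X' kappa kappa' omega omega' psi psi' :
  (forall k, (k <= N)%N -> X (nd k) = X' (nd k)) ->
  (forall k, (k <= N)%N -> kappa (nd k) = kappa' (nd k)) ->
  (forall k, (k <= N)%N -> omega (nd k) = omega' (nd k)) ->
  (forall k, (k <= N)%N -> psi (nd k) = psi' (nd k)) ->
  scheme_form X kappa omega psi = scheme_form X' kappa' omega' psi'.
Proof.
move=> XX kk oo pp; rewrite /scheme_form.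
have := oo _ (leq0n N); have := oo _ (leqnn N).
have := XX _ (leq0n N); have := XX _ (leqnn N).
rewrite node0 nodeN// => -> -> -> ->.
congr (_ * _ + _ - _ + (_ + _) + _).
- by apply: eq_nodal_mass.
- by apply: eq_nodal_stiff.
- by apply: eq_nodal_mass.
- by apply: eq_nodal_stiff => k kN /=; rewrite (oo, XX).
- by apply: eq_nodal_stiff => k kN /=; rewrite (oo, XX).
Qed.

Lemma scheme_load_eq_nodes omega omega' psi psi' :
  (forall k, (k <= N)%N -> omega (nd k) = omega' (nd k)) ->
  (forall k, (k <= N)%N -> psi (nd k) = psi' (nd k)) ->
  scheme_load omega psi = scheme_load omega' psi'.
Proof.
move=> oo pp; rewrite /scheme_load.
have := oo _ (leq0n N); have := oo _ (leqnn N).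
rewrite node0 nodeN// => -> ->.
by congr (_ * _ + _ + _); apply: eq_nodal_mass.
Qed.

(** Testing with omega = 0 or psi = 0 recovers the two equations from the
  combined one. *)
Lemma scheme_solutionP X kappa :
  scheme_solution N tau eta sigma Xm X kappa <->
  [/\ Xh N X, Kh N kappa & forall omega psi, Xh N omega -> Kh N psi ->
    scheme_form X kappa omega psi = scheme_load omega psi].
Proof.
have flowE psi : Xh N X -> Kh N kappa -> Kh N psi ->
    lumped N Xm (fun rho => dot (tau^-1 *: (X rho - Xm rho))
                                (Defs.normal_fun N Xm rho)) psi
      + L2 Xm (ds N Xm kappa) (ds N Xm psi)
    = tau^-1 * (mass X psi - mass Xm psi) + stiff kappa psi.
  move=> XX Kk Kp; rewrite L2_ds//; congr (_ + _).
  have dX : (fun rho => tau^-1 *: (X rho - Xm rho)) =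
      (fun rho => tau^-1 *: ((-1) *: Xm rho + X rho) + 0).
    by apply/funext => rho; rewrite addr0 scaleN1r addrC.
  have XD : Xh N (fun rho => tau^-1 *: (X rho - Xm rho)).
    rewrite dX.
    apply: (@Xh_lin _ (fun rho => (-1) *: Xm rho + X rho) (fun=> 0)).
      exact: Xh_lin.
    exact: Xh_cst0.
  have [XD1 [XD2 _ _]] := XD.
  rewrite (@lumped_normal R N Xm N_gt0
    (fun rho => tau^-1 *: (X rho - Xm rho)))//.
  rewrite dX (@nodal_mass_linl R N Xm tau^-1
    (fun rho => (-1) *: Xm rho + X rho) (fun=> 0)) nodal_mass_linl nodal_mass0l.
  by ring.
have curvE omega : Xh N X -> Kh N kappa -> Xh N omega ->
    lumped N Xm kappa (fun rho => dot (Defs.normal_fun N Xm rho) (omega rho))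
      - L2v Xm (dsv N Xm X) (dsv N Xm omega)
    = mass omega kappa - (stiff (fst \o X) (fst \o omega)
                          + stiff (snd \o X) (snd \o omega)).
  move=> XX Kk Xo; rewrite L2v_dsv//; congr (_ - _).
  have [w1 [w2 _ _]] := Xo; rewrite -lumped_normal//.
  congr (_ * _); apply: eq_bigr => j _.
  have -> : (fun rho =>
        kappa rho * dot (Defs.normal_fun N Xm rho) (omega rho)) =
      (fun rho => dot (omega rho) (Defs.normal_fun N Xm rho) * kappa rho).
    by apply/funext => rho; rewrite mulrC dotC.
  by [].
split.
  move=> [XX Kk flow curv]; split => // omega psi Xo Kp.
  have := flow psi Kp; rewrite flowE//; have := curv omega Xo; rewrite curvE//.
  rewrite /scheme_form /scheme_load.
  by lra.
move=> [XX Kk weak]; split => //.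
  move=> psi Kp; rewrite flowE//.
  have := weak _ psi Xh_cst0 Kp; rewrite /scheme_form /scheme_load nodal_mass0l.
  rewrite (nodal_stiff0r _ _ (fst \o X)) (nodal_stiff0r _ _ (snd \o X)) /=.
  by lra.
move=> omega Xo; rewrite curvE//.
have := weak omega _ Xo (Kh_cst0 R N).
rewrite /scheme_form /scheme_load nodal_stiff0r !nodal_mass0r.
by lra.
Qed.

(** The horizontal displacement of a single node 0 or N is admissible, as only
  the vertical component of a test curve is clamped at the ends. Such a test
  meets one element only, so it isolates the first component of the normal of
  the first or of the last element. *)
Lemma nodal_mass_cst_inj kappa c :
  (forall k, (k <= N)%N -> kappa (nd k) = c) ->
  (forall omega, Xh N omega -> mass omega kappa = 0) -> c = 0.
Proof.
move=> kappa_cst mass0.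
pose tent j (rho : R) : R * R := (hat N j rho, 0).
have Xtent j : Xh N (tent j).
  by split; [exact: Kh_hat|split => //; exact: Kh_cst0].
have tent_node j k : (k <= N)%N -> tent j (nd k) = ((k == j)%:R, 0).
  by move=> kN; rewrite /tent hat_node.
have first_end : c * (normal N Xm 1).1 = 0.
  have := mass0 _ (Xtent 0%N); rewrite /nodal_mass big_ltn//=.
  rewrite big_nat_cond big1 ?addr0; last first.
    move=> j jN; rewrite !tent_node; [|lia|lia].
    have -> : (j == 0)%N = false by lia.
    have -> : (j.-1 == 0)%N = false by lia.
    by rewrite /dot/= !(mul0r, addr0, mulr0).
  rewrite !tent_node// !kappa_cst// /dot/=.
  rewrite !(mul0r, addr0, add0r, mul1r) => /eqP.
  rewrite !mulf_eq0 invr_eq0 pnatr_eq0/= gt_eqF ?len_gt0//=.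
  by case/orP => /eqP ->; rewrite ?mulr0 ?mul0r.
have last_end : c * (normal N Xm N).1 = 0.
  have := mass0 _ (Xtent N); rewrite /nodal_mass big_nat_recr//=.
  rewrite big_nat_cond big1 ?add0r; last first.
    move=> j jN; rewrite !tent_node; [|lia|lia].
    have -> : (j == N)%N = false by lia.
    have -> : (j.-1 == N)%N = false by lia.
    by rewrite /dot/= !(mul0r, addr0, mulr0).
  rewrite !tent_node// ?leq_pred//.
  have -> : (N.-1 == N)%N = false by lia.
  rewrite eqxx kappa_cst// /dot/=.
  rewrite !(mul0r, addr0, add0r, mul1r) => /eqP.
  rewrite !mulf_eq0 invr_eq0 pnatr_eq0/= gt_eqF ?len_gt0 ?N_gt0 ?leqnn//=.
  by case/orP => /eqP ->; rewrite ?mulr0 ?mul0r.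
apply/eqP.
have : c * ((normal N Xm 1).1 ^+ 2 + (normal N Xm N).1 ^+ 2) == 0.
  by rewrite mulrDr !expr2 !mulrA first_end last_end !mul0r addr0.
by rewrite mulf_eq0 => /orP[//|]; rewrite gt_eqF.
Qed.

(** The factor tau in the test for the first equation cancels its tau^-1, so
  that the two lumped terms are opposite. *)
Lemma scheme_form_energy X kappa :
  scheme_form X kappa X (fun rho => tau * kappa rho + 0)
  = tau * stiff kappa kappa
    + (stiff (fst \o X) (fst \o X) + stiff (snd \o X) (snd \o X))
    + (eta * tau)^-1 * ((X 0).1 ^+ 2 + (X 1).1 ^+ 2).
Proof.
rewrite /scheme_form nodal_mass_linr nodal_stiff_linr nodal_mass0r.
by rewrite nodal_stiff0r !addr0 mulrA mulVf ?gt_eqF// mul1r; ring.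
Qed.

(** Vanishing of all differences makes kappa and both components of X constant;
  the constants of X are fixed at the left end, the first by the contact-line
  term and the second by the boundary condition. *)
Lemma scheme_form_energy_eq0 X kappa : Kh0 N (snd \o X) ->
  scheme_form X kappa X (fun rho => tau * kappa rho + 0) = 0 ->
  forall k, (k <= N)%N -> X (nd k) = 0 /\ kappa (nd k) = kappa 0.
Proof.
move=> [_ X20 _]; rewrite scheme_form_energy => energy0.
have et_gt0 : 0 < (eta * tau)^-1 by rewrite invr_gt0 mulr_gt0.
have s0 := nodal_stiff_ge0 min_seg_gt0 kappa.
have s1 := nodal_stiff_ge0 min_seg_gt0 (fst \o X).
have s2 := nodal_stiff_ge0 min_seg_gt0 (snd \o X).
have ts0 : 0 <= tau * stiff kappa kappa by exact: mulr_ge0 (ltW _) _.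
have ends : 0 <= (X 0).1 ^+ 2 + (X 1).1 ^+ 2.
  by apply: addr_ge0; exact: sqr_ge0.
have et_ends : 0 <= (eta * tau)^-1 * ((X 0).1 ^+ 2 + (X 1).1 ^+ 2).
  exact: mulr_ge0 (ltW _) _.
have X10 : (X 0).1 = 0.
  have : (eta * tau)^-1 * ((X 0).1 ^+ 2 + (X 1).1 ^+ 2) == 0 by apply/eqP; lra.
  rewrite mulf_eq0 gt_eqF//= paddr_eq0 ?sqr_ge0// => /andP[+ _].
  by rewrite sqrf_eq0 => /eqP.
have e0 : stiff kappa kappa = 0.
  have : tau * stiff kappa kappa == 0 by apply/eqP; lra.
  by rewrite mulf_eq0 gt_eqF//= => /eqP.
have e1 : stiff (fst \o X) (fst \o X) = 0 by lra.
have e2 : stiff (snd \o X) (snd \o X) = 0 by lra.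
move=> k kN; split; last exact: nodal_stiff_eq0 e0 kN.
have := nodal_stiff_eq0 min_seg_gt0 e1 kN.
have := nodal_stiff_eq0 min_seg_gt0 e2 kN.
rewrite X20 /= X10; case: (X (nd k)) => a b /= -> ->; by [].
Qed.

Lemma scheme_form_nondegenerate X kappa : Xh N X -> Kh N kappa ->
  (forall omega psi, Xh N omega -> Kh N psi ->
    scheme_form X kappa omega psi = 0) ->
  forall k, (k <= N)%N -> X (nd k) = 0 /\ kappa (nd k) = 0.
Proof.
move=> XX Kk form0; have [X1 X2] := XX.
have nodes := scheme_form_energy_eq0 X2
  (form0 _ _ XX (Kh_lin tau Kk (Kh_cst0 R N))).
suff k0 : kappa 0 = 0 by move=> k /nodes[]; rewrite k0.
apply: (@nodal_mass_cst_inj kappa) => [k /nodes[]//|omega Xo].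
have := form0 _ _ Xo (Kh_cst0 R N).
(* As X vanishes at the nodes, only the lumped term in kappa survives. *)
rewrite (@scheme_form_eq_nodes _ (fun=> 0) _ kappa _ omega _ (fun=> 0))//;
    last first.
  by move=> k /nodes[].
rewrite /scheme_form nodal_mass0l nodal_stiff0r.
rewrite (nodal_stiffC _ _ (fst \o _)) (nodal_stiffC _ _ (snd \o _)).
rewrite (nodal_stiff0r _ _ (fst \o omega)) (nodal_stiff0r _ _ (snd \o omega)).
by rewrite /= !mulr0 !addr0 mulr0 add0r addr0 => /eqP; rewrite oppr_eq0 => /eqP.
Qed.

(** The free nodal values: the first component of the curve at all nodes, the
  second at the interior nodes, the curvature at all nodes. *)
Let dofs := ('rV[R]_N.+1 * 'rV[R]_N.-1 * 'rV[R]_N.+1)%type.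

Definition dof_curve (v : dofs) (rho : R) : R * R :=
  (interp N 0 v.1.1 rho, interp N 1 v.1.2 rho).

Definition dof_curvature (v : dofs) : R -> R := interp N 0 v.2.

Lemma Xh_dof_curve v : Xh N (dof_curve v).
Proof. by split; [exact: Kh_interp|exact: Kh0_interp]. Qed.

Lemma dof_curve_lin a u v :
  dof_curve (a *: u + v) = (fun rho => a *: dof_curve u rho + dof_curve v rho).
Proof.
by apply/funext => rho; rewrite /dof_curve /= !interp_lin.
Qed.

Lemma dof_curvature_lin a u v : dof_curvature (a *: u + v) =
  (fun rho => a * dof_curvature u rho + dof_curvature v rho).
Proof. by apply/funext => rho; rewrite /dof_curvature /= interp_lin. Qed.

Lemma dofs_of (omega : R -> R * R) psi : Xh N omega -> exists v : dofs,
  forall k, (k <= N)%N ->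
    omega (nd k) = dof_curve v (nd k) /\ psi (nd k) = dof_curvature v (nd k).
Proof.
move=> [_ [_ o20 o21]].
exists (\row_i (omega (nd i)).1, \row_i (omega (nd i.+1)).2, \row_i psi (nd i)).
move=> k kN; rewrite /dof_curve /dof_curvature/=.
rewrite (interp_nodal N_gt0 (fst \o omega))// (interp_nodal N_gt0 psi)//.
rewrite (interp_nodal0 N_gt0 (u := snd \o omega))//.
by split => //=; case: (omega _).
Qed.

Lemma dofs_eq0 (v : dofs) :
  (forall k, (k <= N)%N ->
    dof_curve v (nd k) = 0 /\ dof_curvature v (nd k) = 0) ->
  v = 0.
Proof.
case: v => [[x y] c] v0.
have row0 m s (r : 'rV[R]_m) : (m + s <= N.+1)%N ->
    (forall k, (k <= N)%N -> interp N s r (nd k) = 0) -> r = 0.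
  move=> msN r0; apply/rowP => i; rewrite mxE -(interp_node N_gt0 r i msN) r0//.
  by have := ltn_ord i; lia.
have -> : x = 0.
  by apply: (row0 _ 0%N); rewrite ?addn0// => k /v0[[]].
have -> : y = 0.
  by apply: (row0 _ 1%N); [lia|] => k /v0[[]].
have -> : c = 0 by apply: (row0 _ 0%N); rewrite ?addn0// => k /v0[].
by [].
Qed.

(** Testing with interpolated nodal values is as strong as testing with all of
  X^h x K^h, because the form and the load see a test only at the nodes. *)
Lemma scheme_weak_existence : exists X kappa,
  [/\ Xh N X, Kh N kappa & forall omega psi, Xh N omega -> Kh N psi ->
    scheme_form X kappa omega psi = scheme_load omega psi].
Proof.
pose form (u v : dofs) := scheme_form (dof_curve u) (dof_curvature u)
  (dof_curve v) (dof_curvature v).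
have [] := @nondegenerate_form_solvable R dofs form
  (fun v => scheme_load (dof_curve v) (dof_curvature v)).
- move=> v a u u'.
  by rewrite /form dof_curve_lin dof_curvature_lin scheme_form_linl.
- move=> v a u u'.
  by rewrite /form dof_curve_lin dof_curvature_lin scheme_form_linr.
- by move=> a u u'; rewrite dof_curve_lin dof_curvature_lin scheme_load_lin.
- move=> u form0; apply: dofs_eq0; apply: scheme_form_nondegenerate.
  + exact: Xh_dof_curve.
  + exact: Kh_interp.
  + move=> omega psi Xo Kp; have [v vE] := dofs_of psi Xo.
    rewrite -[RHS](form0 v); by apply: scheme_form_eq_nodes => // k kN;
      have [] := vE k kN.
move=> u uE; exists (dof_curve u), (dof_curvature u); split.
- exact: Xh_dof_curve.
- exact: Kh_interp.
move=> omega psi Xo Kp; have [v vE] := dofs_of psi Xo.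
transitivity (form u v).
  by apply: scheme_form_eq_nodes => // k kN; have [] := vE k kN.
rewrite uE; apply: scheme_load_eq_nodes => k kN; by have [] := vE k kN.
Qed.

Lemma scheme_weak_uniqueness X kappa X' kappa' :
  Xh N X -> Kh N kappa -> Xh N X' -> Kh N kappa' ->
  (forall omega psi, Xh N omega -> Kh N psi ->
    scheme_form X' kappa' omega psi = scheme_form X kappa omega psi) ->
  {in `[0, 1], X' =1 X} /\ {in `[0, 1], kappa' =1 kappa}.
Proof.
move=> XX Kk XX' Kk' same.
have diff0 k : (k <= N)%N -> (-1) *: X (nd k) + X' (nd k) = 0 /\
    -1 * kappa (nd k) + kappa' (nd k) = 0.
  apply: (scheme_form_nondegenerate (Xh_lin (-1) XX XX') (Kh_lin (-1) Kk Kk')).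
  by move=> omega psi Xo Kp; rewrite scheme_form_linl (same _ _ Xo Kp); ring.
have nodes k : (k <= N)%N ->
    X' (nd k) = X (nd k) /\ kappa' (nd k) = kappa (nd k).
  move=> /diff0[Xk kk]; split; last by lra.
  by move: Xk; rewrite scaleN1r addrC => /eqP; rewrite subr_eq0 => /eqP.
have [[X1 [X2 _ _]] [X1' [X2' _ _]]] := (XX, XX').
have e1 := eq_Kh N_gt0 X1' X1 (fun k kN => congr1 fst (nodes k kN).1).
have e2 := eq_Kh N_gt0 X2' X2 (fun k kN => congr1 snd (nodes k kN).1).
split; last by apply: (eq_Kh N_gt0) => // k /nodes[].
move=> rho rho01; have := e1 rho rho01; have := e2 rho rho01 => /=.
by case: (X rho) => a b; case: (X' rho) => a' b' /= -> ->.
Qed.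

End Scheme.

Theorem theorem4p1 (R : realType) (N : nat) (hN : (1 <= N)%N)
    (tau eta sigma : R) (htau : 0 < tau) (heta : 0 < eta)
    (hsigma : -1 < sigma < 1)
    (Xm : R -> R * R) (hXm : Xh N Xm)
    (h_i : 0 < (normal N Xm 1).1 ^+ 2 + (normal N Xm N).1 ^+ 2)
    (h_ii : 0 < min_seg N Xm) :
  exists (X : R -> R * R) (kappa : R -> R),
    scheme_solution N tau eta sigma Xm X kappa /\
    forall (X' : R -> R * R) (kappa' : R -> R),
      scheme_solution N tau eta sigma Xm X' kappa' ->
      {in `[0, 1], X' =1 X} /\ {in `[0, 1], kappa' =1 kappa}.
Proof.
have [X [kappa [XX Kk weak]]] :=
  scheme_weak_existence sigma hN htau heta h_i h_ii.
exists X, kappa; split; first by apply/scheme_solutionP.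
move=> X' kappa' /scheme_solutionP[]// XX' Kk' weak'.
apply: (scheme_weak_uniqueness hN htau heta h_i h_ii) => // omega psi Xo Kp.
by rewrite weak// weak'.
Qed.
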